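(* Let $f:\mathbb{N}\to\mathbb{N}$ be an increasing function. If $f(n) \not\preceq \exp(\exp(n))$, then $B_f$ is not finitely presentable.
   Context: $\mathbb{N}=\{1,2,\ldots\}$. Comparison: for functions $f_1,f_2$ from $\mathbb{N}$ to $(0,\infty)$, $f_1\preceq f_2$ means that there is a constant $C>0$ with $f_1(n)\le f_2(Cn)$ for all $n\in\mathbb{N}$, where functions on $\mathbb{N}$ are evaluated at real $x>0$ by $f(x)=f(\lceil x\rceil)$. The groups $N(d,q)$: for $m\in\mathbb{N}$, $m\geq 3$, let $\alpha_m=(1\;2\cdots m)$ and $\beta_m=(1\;2\;3)$ in $\mathrm{Sym}(m)$. For functions $d,q:\mathbb{N}\to\mathbb{N}$ with all values of $d$ odd integers at least $5$, let $s=(\alpha_{d(n)}^{q(n)})_n$ and $t=(\beta_{d(n)})_n$ in $\prod_{n\in\mathbb{N}}\mathrm{Alt}(d(n))$, and let $N(d,q)=\langle s,t\rangle$. The groups $B_f$: given an increasing function $f:\mathbb{N}\to\mathbb{N}$ with $f(n)\ge n$ for all $n$ (automatic for strictly increasing $f$), there exist functions $d,p,q:\mathbb{N}\to\mathbb{N}$ such that for all $n$: (i) $p$ is odd-valued, strictly increasing and $p(1)=1$; (ii) $q(n)\ge 3$ is odd; (iii) $d(n)=p(n)q(n)+2$; (iv) $d(n)\ge 2f(4p(n+1)+4)$ is odd; (v) for all $i\le n$, $p(n+1)q(i)\not\equiv \pm1,\pm2 \pmod{d(i)}$. Fix such $d,p,q$ and set $B_f=N(d,q)$. *)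

(* Defs.v *)
From HB Require Import structures.
From mathcomp Require Import all_boot all_order all_fingroup all_algebra all_solvable.
From mathcomp Require Import boolp classical_sets reals sequences.

Set Implicit Arguments.
Unset Strict Implicit.
Unset Printing Implicit Defensive.

Import Order.TTheory GRing.Theory Num.Theory.

Local Open Scope group_scope.

(* The group <x_0, ..., x_(k-1) | R>: words in the letters x_i^(+1), x_i^(-1),
   modulo the smallest congruence identifying x x^-1, x^-1 x and the relators
   with the empty word.  The letter (i, b) stands for x_i if b = false and for
   x_i^-1 if b = true. *)

Definition word (k : nat) := seq ('I_k * bool).

Definition word_inv k (w : word k) : word k :=
  rev [seq (a.1, ~~ a.2) | a <- w].

Inductive word_equiv k (R : seq (word k)) : word k -> word k -> Prop :=
| WordRefl u : word_equiv R u u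
| WordSym u v : word_equiv R u v -> word_equiv R v u
| WordTrans u v w : word_equiv R u v -> word_equiv R v w -> word_equiv R u w
| WordCat u u' v v' :
    word_equiv R u u' -> word_equiv R v v' -> word_equiv R (u ++ v) (u' ++ v')
| WordCancel i b : word_equiv R [:: (i, b); (i, ~~ b)] [::]
| WordRelator r : r \in R -> word_equiv R r [::].

Lemma word_inv_cat k (u v : word k) :
  word_inv (u ++ v) = word_inv v ++ word_inv u.
Proof. by rewrite /word_inv map_cat rev_cat. Qed.

Lemma word_invK k : involutive (@word_inv k).
Proof.
move=> w; rewrite /word_inv map_rev revK -map_comp map_id_in //.
by case=> i b _ /=; rewrite negbK.
Qed.

Lemma word_mulV k (R : seq (word k)) u : word_equiv R (u ++ word_inv u) [::].
Proof.
elim: u => [|[i b] u IH]; first exact: WordRefl.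
rewrite -cat1s word_inv_cat -catA (catA u).
apply: (@WordTrans _ _ _ ([:: (i, b)] ++ ([::] ++ word_inv [:: (i, b)]))).
  by apply: WordCat; [exact: WordRefl | apply: WordCat => //; exact: WordRefl].
exact: WordCancel.
Qed.

Lemma word_Vmul k (R : seq (word k)) u : word_equiv R (word_inv u ++ u) [::].
Proof. by rewrite -{2}[u]word_invK; exact: word_mulV. Qed.

Lemma word_equiv_inv k (R : seq (word k)) u v :
  word_equiv R u v -> word_equiv R (word_inv u) (word_inv v).
Proof.
move=> uv.
apply: (@WordTrans _ _ _ (word_inv u ++ (v ++ word_inv v))).
  rewrite -{1}[word_inv u]cats0; apply: WordCat; first exact: WordRefl.
  exact/WordSym/word_mulV.
rewrite catA -{2}[word_inv v]cat0s; apply: WordCat; last exact: WordRefl.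
apply: WordTrans (word_Vmul R u); apply: WordCat; first exact: WordRefl.
exact: WordSym.
Qed.

(* fingroup also exports a repr. *)
Local Notation qrepr := generic_quotient.repr.

Section PresentedGroup.
Variables (k : nat) (R : seq (word k)).

Definition word_equivb : rel (word k) := fun u v => `[< word_equiv R u v >].

Fact word_equivb_equiv : equiv_class_of word_equivb.
Proof.
split=> [u|u v|v u w]; first exact/asboolP/WordRefl.
  by apply/asboolP/asboolP; exact: WordSym.
by move=> /asboolP uv /asboolP vw; apply/asboolP; exact: WordTrans uv vw.
Qed.

Canonical word_equiv_rel := EquivRelPack word_equivb_equiv.

Definition presented_group : Type := {eq_quot word_equiv_rel}%qT.

HB.instance Definition _ : EqQuotient _ word_equiv_rel presented_group :=
  EqQuotient.on presented_group.
HB.instance Definition _ := Choice.on presented_group.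

Definition word_class (w : word k) : presented_group :=
  (\pi_presented_group w)%qT.
Definition pres_mul (x y : presented_group) :=
  word_class (qrepr x ++ qrepr y).
Definition pres_one := word_class [::].
Definition pres_inv (x : presented_group) :=
  word_class (word_inv (qrepr x)).

Lemma word_classP u v : word_class u = word_class v <-> word_equiv R u v.
Proof.
split=> [/eqmodP /asboolP //|uv]; exact/eqmodP/asboolP.
Qed.

Lemma word_class_repr x : word_class (qrepr x) = x.
Proof. exact: reprK. Qed.

Lemma repr_word_class u : word_equiv R (qrepr (word_class u)) u.
Proof. exact/word_classP/word_class_repr. Qed.

Lemma word_classM u v : pres_mul (word_class u) (word_class v) = word_class (u ++ v).
Proof. by apply/word_classP/WordCat; exact: repr_word_class. Qed.

Lemma word_classV u : pres_inv (word_class u) = word_class (word_inv u).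
Proof. by apply/word_classP/word_equiv_inv; exact: repr_word_class. Qed.

Fact pres_mulA : associative pres_mul.
Proof.
move=> x y z; rewrite -(word_class_repr x) -(word_class_repr y) -(word_class_repr z).
by rewrite !word_classM catA.
Qed.

Fact pres_mul1 : left_id pres_one pres_mul.
Proof. by move=> x; rewrite -(word_class_repr x) word_classM. Qed.

Fact pres_1mul : right_id pres_one pres_mul.
Proof. by move=> x; rewrite -(word_class_repr x) word_classM cats0. Qed.

Fact pres_mulV : left_inverse pres_one pres_inv pres_mul.
Proof.
move=> x; rewrite -(word_class_repr x) word_classV word_classM.
exact/word_classP/word_Vmul.
Qed.

Fact pres_Vmul : right_inverse pres_one pres_inv pres_mul.
Proof.
move=> x; rewrite -(word_class_repr x) word_classV word_classM.
exact/word_classP/word_mulV.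
Qed.

HB.instance Definition _ := isGroup.Build presented_group
  pres_mulA pres_mul1 pres_1mul pres_mulV pres_Vmul.

End PresentedGroup.

Definition finitely_presentable (G : groupType) : Prop :=
  exists (k : nat) (R : seq (word k)) (h : presented_group R -> G),
    {morph h : x y / x * y} /\ bijective h.

Section ProductGroup.
Variables (I : Type) (G : I -> groupType).

Definition product_group : Type := forall i, G i.

HB.instance Definition _ := Choice.copy product_group (forall i, G i).

Implicit Types x y z : product_group.

Definition prodg_mul x y : product_group := fun i => x i * y i.
Definition prodg_one : product_group := fun=> 1.
Definition prodg_inv x : product_group := fun i => (x i)^-1.

Fact prodg_mulA : associative prodg_mul.
Proof. by move=> x y z; apply: functional_extensionality_dep => i; exact: mulgA. Qed.
Fact prodg_mul1 : left_id prodg_one prodg_mul.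
Proof. by move=> x; apply: functional_extensionality_dep => i; exact: mul1g. Qed.
Fact prodg_1mul : right_id prodg_one prodg_mul.
Proof. by move=> x; apply: functional_extensionality_dep => i; exact: mulg1. Qed.
Fact prodg_mulV : left_inverse prodg_one prodg_inv prodg_mul.
Proof. by move=> x; apply: functional_extensionality_dep => i; exact: mulVg. Qed.
Fact prodg_Vmul : right_inverse prodg_one prodg_inv prodg_mul.
Proof. by move=> x; apply: functional_extensionality_dep => i; exact: mulgV. Qed.

HB.instance Definition _ := isGroup.Build product_group
  prodg_mulA prodg_mul1 prodg_1mul prodg_mulV prodg_Vmul.

End ProductGroup.

Section GeneratedSubgroup.
Variables (G : groupType) (S : set G).

(* The intersection of all subgroups of G containing S. *)
Definition gen_subgroup : {pred G} := fun x =>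
  `[< forall H : {pred G}, group_closed H -> (forall y, S y -> y \in H) ->
      x \in H >].

Fact gen_subgroup_closed : group_closed gen_subgroup.
Proof.
split=> [|x y /asboolP gx /asboolP gy]; apply/asboolP => H clH sSH.
  exact: clH.1.
by apply: clH.2; [exact: gx | exact: gy].
Qed.

Lemma sub_gen_subgroup x : S x -> x \in gen_subgroup.
Proof. by move=> Sx; apply/asboolP => H _; exact. Qed.

Record gen_group : Type :=
  GenGroup { gval : G; gvalP : gval \in gen_subgroup }.

HB.instance Definition _ := [isSub for gval].
HB.instance Definition _ := [Choice of gen_group by <:].
HB.instance Definition _ := SubChoice_isSubGroup.Build G gen_subgroup gen_group
  gen_subgroup_closed.

End GeneratedSubgroup.

(* alpha m is the m-cycle (1 2 ... m) and beta m is the 3-cycle (1 2 3), with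
   the points renamed 0, ..., m-1; beta m is a junk value for m < 3. *)

Definition alpha (m : nat) : 'S_m := perm (can_inj (@ordSK m)).

Definition beta (m : nat) : 'S_m :=
  match m return 'S_m with
  | k.+3 => tperm (inord 0) (inord 1) * tperm (inord 0) (inord 2)
  | _ => 1
  end.

Lemma alphaE m (i : 'I_m) : alpha m i = i.+1 %% m :> nat.
Proof. by rewrite permE. Qed.

Lemma betaE m (i : 'I_m) : 2 < m ->
  beta m i = (if i < 3 then i.+1 %% 3 else i) :> nat.
Proof.
case: m i => [|[|[|k]]] // [[|[|[|i]]] lti] _ /=; rewrite permM !permE /= -!val_eqE /= !inordK //=.
all: by rewrite -?val_eqE /= ?inordK.
Qed.

Lemma alpha_even m : odd m -> ~~ odd_perm (alpha m).
Proof.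
move=> odd_m.
have alphaX k i : (alpha m ^+ k) i = (i + k) %% m :> nat.
  elim: k => [|k IH]; first by rewrite perm1 addn0 modn_small.
  by rewrite expgSr permM alphaE IH -addn1 modnDml addn1 addnS.
have alpham : alpha m ^+ m = 1.
  by apply/permP => i; apply/val_inj; rewrite /= alphaX modnDr modn_small ?perm1.
have oddX k : odd_perm (alpha m ^+ k) = odd k && odd_perm (alpha m).
  elim: k => [|k IH]; first by rewrite odd_perm1.
  by rewrite expgS odd_permM IH oddS; case: (odd k); case: (odd_perm _).
by move: (oddX m); rewrite alpham odd_perm1 odd_m /= => <-.
Qed.

Lemma beta_even m : 2 < m -> ~~ odd_perm (beta m).
Proof.
case: m => [|[|[|k]]] // _.
by rewrite odd_permM !odd_tperm -!val_eqE /= !inordK.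
Qed.

(* The index set {1, 2, ...}.  Functions on it are represented by
   functions on nat whose value at 0 is irrelevant. *)
Definition posnat := {n : nat | 0 < n}.

Section GroupN.
Variables d q : nat -> nat.

Definition prod_sym := product_group (fun n : posnat => 'S_(d (val n))).

Definition gen_s : prod_sym := fun n => alpha (d (val n)) ^+ q (val n).
Definition gen_t : prod_sym := fun n => beta (d (val n)).

(* Generated inside the product of the symmetric groups; by gen_s_Alt and
   gen_t_Alt, the generators lie in the product of the alternating groups when
   d takes odd values at least 5. *)
Definition groupN : groupType :=
  gen_group [set x : prod_sym | x = gen_s \/ x = gen_t]%classic.

Lemma gen_s_Alt n : odd (d (val n)) -> gen_s n \in 'Alt_('I_(d (val n))).
Proof.
rewrite Alt_even /gen_s => odd_d.
elim: (q _) => [|k IH]; first by rewrite odd_perm1.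
by rewrite expgS odd_permM (negbTE (alpha_even odd_d)).
Qed.

Lemma gen_t_Alt n : 2 < d (val n) -> gen_t n \in 'Alt_('I_(d (val n))).
Proof. by move=> dn; rewrite Alt_even /gen_t beta_even. Qed.

End GroupN.

Local Open Scope nat_scope.

(* For every d, p, q as follows, groupN d q is a group B_f. *)
Record B_parameters (f d p q : nat -> nat) : Prop := {
  B_p_odd : forall n, 0 < n -> odd (p n);
  B_p_strict : forall m n, 0 < m -> m < n -> p m < p n;
  B_p_one : p 1 = 1;
  B_q_ge3 : forall n, 0 < n -> 3 <= q n;
  B_q_odd : forall n, 0 < n -> odd (q n);
  B_d_def : forall n, 0 < n -> d n = p n * q n + 2;
  B_d_ge : forall n, 0 < n -> 2 * f (4 * p n.+1 + 4) <= d n;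
  B_d_odd : forall n, 0 < n -> odd (d n);
  B_pq_neq : forall n i, 0 < i <= n -> forall r : int, r \in [:: 1; -1; 2; -2]%R ->
    ((p n.+1 * q i)%N%:Z != r %[mod (d i)%:Z])%Z
}.

(* Functions on {1, 2, ...} are evaluated at real x > 0 through the ceiling. *)
Definition preceq (R : realType) (f1 f2 : nat -> R) : Prop :=
  exists2 C : R, (0 < C)%R &
    forall n, 0 < n -> (f1 n <= f2 (absz (Num.ceil (C * n%:R))))%R.

(* Main.v *)
Require Import Defs.
From HB Require Import structures.
From mathcomp Require Import all_boot all_order all_fingroup all_algebra zify.
From mathcomp Require Import boolp classical_sets reals sequences.

(* A coordinate of N(d, q) is a group <s, t> of permutations of Z/m, m = pq + 2,
   with s : x |-> x + q and t = (0 1 2).  Since pq = -2 mod m, the conjugates of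
   t by s^k with 0 < 2|k| < p have supports disjoint from that of t, so in the
   coordinates with large p, words of bounded length behave as in C_3 wr Z.  If
   N(d, q) were finitely presentable, finitely many relators in s, t would
   define it; they hold in C_3 wr Z, hence in any group <s', t'> of the same
   shape with p = a large enough, for every odd q.  So N(d, q) would map onto
   that group, with s |-> s' and t |-> t'.  But in N(d, q) the element
   c = [t, t^(s^a)] is trivial in all coordinates with p > 2a, so it commutes
   with a power s^M killing the finitely many others, where M depends only on a;
   whereas s'^M moves the support of the nontrivial element [t', t'^(s'^a)], of
   size at most 5, off itself when q is large. *)

Set Implicit Arguments.
Unset Strict Implicit.
Import Order.TTheory GRing.Theory Num.Theory.

(** * Evaluation of words, and change of generators in a finite presentation *)

Section WordEval.
Local Open Scope group_scope.

Definition word_eval k (G : groupType) (g : 'I_k -> G) (w : word k) : G :=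
  \prod_(a <- w) (if a.2 then (g a.1)^-1 else g a.1).

Lemma word_eval_cons k (G : groupType) (g : 'I_k -> G) a w :
  word_eval g (a :: w) = (if a.2 then (g a.1)^-1 else g a.1) * word_eval g w.
Proof. exact: big_cons. Qed.

Lemma word_eval1 k (G : groupType) (g : 'I_k -> G) a :
  word_eval g [:: a] = if a.2 then (g a.1)^-1 else g a.1.
Proof. exact: big_seq1. Qed.

Lemma word_eval_cat k (G : groupType) (g : 'I_k -> G) u v :
  word_eval g (u ++ v) = word_eval g u * word_eval g v.
Proof. exact: big_cat. Qed.

Lemma word_eval_inv k (G : groupType) (g : 'I_k -> G) w :
  word_eval g (word_inv w) = (word_eval g w)^-1.
Proof.
elim: w => [|[i b] w IH]; first by rewrite /word_eval !big_nil invg1.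
rewrite -cat1s word_inv_cat !word_eval_cat invgM IH !word_eval1 /=.
by case: b; rewrite ?invgK.
Qed.

Lemma word_eval_morph k (G H : groupType) (f : UMagmaMorphism.type G H)
    (g : 'I_k -> G) w :
  f (word_eval g w) = word_eval (f \o g) w.
Proof.
by rewrite gmulf_prod; apply: eq_bigr => -[i []] _ //=; rewrite gmulfV.
Qed.

Definition word_subst k m (u : 'I_k -> word m) (w : word k) : word m :=
  flatten [seq if a.2 then word_inv (u a.1) else u a.1 | a <- w].

Lemma word_eval_subst k m (G : groupType) (g : 'I_m -> G) (u : 'I_k -> word m) w :
  word_eval g (word_subst u w) = word_eval (fun i => word_eval g (u i)) w.
Proof.
elim: w => [|[i b] w IH]; first by rewrite /word_eval !big_nil.
by rewrite [word_subst _ _]/= word_eval_cat word_eval_cons IH; case: b;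
  rewrite //= word_eval_inv.
Qed.

Lemma word_equiv_eval k (R : seq (word k)) (G : groupType) (g : 'I_k -> G) u v :
  (forall r, r \in R -> word_eval g r = 1) ->
  word_equiv R u v -> word_eval g u = word_eval g v.
Proof.
move=> Rg; elim=> // {u v}.
- by move=> u v w _ -> _ ->.
- by move=> u u' v v' _ eu _ ev; rewrite !word_eval_cat eu ev.
- move=> i b; rewrite !word_eval_cons /word_eval !big_nil /= mulg1.
  by case: b; rewrite /= ?mulVg ?mulgV.
by move=> r /Rg ->; rewrite /word_eval big_nil.
Qed.

Lemma word_eval_class k (R : seq (word k)) (w : word k) :
  word_eval (fun i => word_class R [:: (i, false)] : presented_group R) w =
  word_class R w.
Proof.
elim: w => [|[i b] w IH]; first by rewrite /word_eval big_nil.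
rewrite word_eval_cons IH /= -[X in _ = word_class _ X]cat1s -word_classM.
by case: b => //; congr (_ * _); apply: word_classV.
Qed.

(** A Tietze change of generators: finite presentability does not depend on the generating tuple.
    The new presentation is stated through von Dyck's universal property, the form in which it is
    applied. *)
Lemma finitely_presentable_relators (G : groupType) m (g : 'I_m -> G) :
  finitely_presentable G -> (forall x, exists w, word_eval g w = x) ->
  exists2 R : seq (word m), (forall r, r \in R -> word_eval g r = 1) &
    forall (H : groupType) (h : 'I_m -> H),
      (forall r, r \in R -> word_eval h r = 1) ->
      exists f : UMagmaMorphism.type G H, forall i, f (g i) = h i.
Proof.
move=> [k [R [e [eM [e' eK e'K]]]]] g_gen.
have e1 : e 1 = 1 by apply: (mulgI (e 1)); rewrite -eM !mulg1.
pose eH := isUMagmaMorphism.Build _ _ e (e1, eM).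
pose E : UMagmaMorphism.type _ _ := HB.pack e eH.
pose x i := e (word_class R [:: (i, false)]).
have evx w : word_eval x w = e (word_class R w).
  by rewrite -word_eval_class -[e]/(E : _ -> _) word_eval_morph.
have [u uE] := boolp.choice (fun i => g_gen (x i)).
have xS z : exists w, word_eval x w = z.
  by exists (generic_quotient.repr (e' z)); rewrite evx word_class_repr e'K.
have [v vE] := boolp.choice (fun i => xS (g i)).
have evu w : word_eval g (word_subst u w) = word_eval x w.
  by rewrite word_eval_subst; congr word_eval; apply: functional_extensionality_dep.
(* The old relators rewritten in terms of g, and the relators equating each
   g i with its expression in the old generators. *)
exists ([seq word_subst u r | r <- R] ++
        [seq word_inv [:: (i, false)] ++ word_subst u (v i) | i <- enum 'I_m]).
  move=> r; rewrite mem_cat => /orP[] /mapP[z zP ->].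
    by rewrite evu evx -e1; congr e; apply/word_classP/WordRelator.
  by rewrite word_eval_cat word_eval_inv word_eval1 evu vE mulVg.
move=> H h hR; pose y i := word_eval h (u i).
have yR r : r \in R -> word_eval y r = 1.
  by move=> rR; rewrite -word_eval_subst hR // mem_cat map_f.
(* The value is read off a chosen word for [z]; [fE] shows that every word gives the same value. *)
pose f z := word_eval y (generic_quotient.repr (e' z)).
have fE w : f (word_eval x w) = word_eval y w.
  by rewrite /f evx eK; apply: word_equiv_eval yR _; apply: repr_word_class.
have fM : {morph f : z t / z * t^-1}.
  move=> z t; have [wz <-] := xS z; have [wt <-] := xS t.
  by rewrite -word_eval_inv -word_eval_cat !fE word_eval_cat word_eval_inv.
pose fH := isGroupMorphism.Build _ _ f fM.
pose F : UMagmaMorphism.type _ _ := HB.pack f fH; exists F => i /=.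
rewrite -vE fE -word_eval_subst.
have hi : word_eval h (word_inv [:: (i, false)] ++ word_subst u (v i)) = 1.
  by apply: hR; rewrite mem_cat; apply/orP; right; apply/mapP; exists i;
    rewrite ?mem_enum.
rewrite word_eval_cat word_eval_inv word_eval1 in hi.
by apply: (mulgI (h i)^-1); rewrite hi mulVg.
Qed.

Lemma gen_group_word_eval (G : groupType) (S : set G) k
    (g : 'I_k -> gen_group S) :
  (forall y, S y -> exists i, y = val (g i)) ->
  forall x, exists w, word_eval g w = x.
Proof.
move=> Sg x.
have /asboolP gx := Defs.gvalP x.
pose H : {pred G} := fun y => `[< exists w, val (word_eval g w) = y >].
have /asboolP[w wx] : val x \in H.
  apply: gx => [|y /Sg[i ->]]; last first.
    by apply/asboolP; exists [:: (i, false)]; rewrite word_eval1.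
  split=> [|y z /asboolP[u <-] /asboolP[v <-]]; apply/asboolP.
    by exists [::]; rewrite /word_eval big_nil.
  by exists (u ++ word_inv v); rewrite word_eval_cat word_eval_inv.
by exists w; apply: val_inj.
Qed.

End WordEval.

(** * Shifts by [q] modulo [m], as divisibility of integers *)

Section Coordinates.
Local Open Scope ring_scope.

Definition coord_gen (m q : nat) (i : 'I_2) : 'S_m :=
  if i == ord0 then (alpha m ^+ q)%g else beta m.

Lemma shiftP m q (x : 'I_m) : (m %| ((alpha m ^+ q : 'S_m)%g x)%:Z - (x%:Z + q%:Z))%Z.
Proof.
elim: q => [|q IH]; first by rewrite expg0 perm1 addr0 subrr dvdz0.
rewrite expgSr permM alphaE; set y := fun_of_perm _ x in IH *.
have := divn_eq y.+1 m; move/dvdzP: IH => [c Hc] Hy.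
by apply/dvdzP; exists (c - (y.+1 %/ m)%N%:Z); lia.
Qed.

(* s^k does not shift {0, 1, 2} onto a set that meets it, for 0 < |k| <= L. *)
Definition separated (m q L : nat) : Prop :=
  forall k r : int, `|k| <= L%:Z -> `|r| <= 2 -> (m %| k * q%:Z + r)%Z -> k = 0.

Lemma dvdz_small (m : nat) (x : int) : (m %| x)%Z -> `|x| < m%:Z -> x = 0.
Proof.
move=> /dvdzP[c ->]; case: (c =P 0) => [->|c0]; first by rewrite mul0r.
by nia.
Qed.

(** Multiply [k * q + r] by [p]: since pq = -2 mod pq + 2, this gives 2k = rp modulo pq + 2, and the
    size bound makes the congruence an equality. *)
Lemma dvdz_pq (p q : nat) (k r : int) :
  `|r| * p%:Z + 2 * `|k| < (p * q + 2)%N%:Z ->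
  ((p * q + 2)%N %| k * q%:Z + r)%Z -> 2 * k = r * p%:Z.
Proof.
move=> small /dvdzP[c Hc].
have H : 2 * k - r * p%:Z = (k - p%:Z * c) * (p * q + 2)%N%:Z.
  have -> : (k - p%:Z * c) * (p * q + 2)%N%:Z =
            k * (p%:Z * q%:Z + 2) - p%:Z * (c * (p * q + 2)%N%:Z) by lia.
  by rewrite -Hc; lia.
apply/eqP; rewrite -subr_eq0; apply/eqP; apply: (@dvdz_small (p * q + 2)%N).
  by rewrite H dvdz_mull.
by apply: le_lt_trans small; nia.
Qed.

Lemma alphaX_dvd m k : (m %| k)%N -> (alpha m ^+ k)%g = 1%g.
Proof.
move=> /dvdnP[e ->]; apply/permP => x; rewrite perm1; apply/val_inj => /=.
set z := fun_of_perm _ x.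
have : (m %| z%:Z - (x%:Z + (e * m)%N%:Z))%Z := shiftP (e * m) x.
move=> /dvdzP[c cE]; have : z%:Z - x%:Z = 0; last by lia.
apply: (@dvdz_small m); last by have := ltn_ord x; have := ltn_ord z; lia.
by apply/dvdzP; exists (c + e%:Z); lia.
Qed.

(** The bound in [dvdz_pq] holds as 2p + 2L < 3p <= pq; then 2k = rp with |2k| < p forces r = 0. *)
Lemma separated_pq (p q L : nat) :
  (2 * L < p)%N -> (3 <= q)%N -> separated (p * q + 2) q L.
Proof.
move=> Lp q3 k r kL r2 /dvdz_pq H.
have {H} : 2 * k = r * p%:Z by apply: H; nia.
by case: (r =P 0) => [->|r0]; [lia | nia].
Qed.

Lemma separatedW m q L L' : (L' <= L)%N -> separated m q L -> separated m q L'.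
Proof. by move=> ? H k r ? ?; apply: H => //; lia. Qed.

(** * Comparison of a coordinate with C_3 wr Z *)

(* The permutation action of the wreath product C_3 wr Z, which the coordinates
   of N(d, q) approximate: (i, k) stands for the point i + k q. *)
Definition wreath_step (y : 'I_3 * int) (a : 'I_2 * bool) : 'I_3 * int :=
  if a.1 == ord0 then (y.1, if a.2 then y.2 - 1 else y.2 + 1)
  else if y.2 == 0 then (if a.2 then ord_pred y.1 else ordS y.1, y.2) else y.

Definition wreath_act (w : word 2) (y : 'I_3 * int) := foldl wreath_step y w.

Definition stands_for (m q : nat) (y : 'I_3 * int) (x : 'I_m) : Prop :=
  (m %| x%:Z - (y.1%:Z + y.2 * q%:Z))%Z.

(* Within L steps of y along its s-orbit, {0, 1, 2} is met only at k = 0. *)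
Definition isolated (m q L : nat) (y : 'I_3 * int) : Prop :=
  forall (k : int) (j : 'I_3), `|k| <= L%:Z ->
    (m %| y.1%:Z + (y.2 + k) * q%:Z - j%:Z)%Z -> y.2 + k = 0.

Lemma separated_isolated m q L (y : 'I_3 * int) :
  separated m q (`|y.2| + L) -> isolated m q L y.
Proof.
move=> sep k j kL; rewrite addrAC addrC => /sep; apply; first by lia.
by have := ltn_ord j; have := ltn_ord y.1; lia.
Qed.

Lemma stands_for0 m q (i : 'I_3) (x : 'I_m) : (2 < m)%N ->
  stands_for q (i, 0) x -> x = i :> nat.
Proof.
rewrite /stands_for /= mul0r addr0 => m3 /dvdz_small H.
have : x%:Z - i%:Z = 0 by apply: H; have := ltn_ord x; have := ltn_ord i; lia.
by lia.
Qed.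

(** Point and description agree on whether the 3-cycle acts: x < 3 forces y.2 = 0 by isolation, and
    y.2 = 0 forces x = y.1 < 3. *)
Lemma beta_stands_for m q (y : 'I_3 * int) (x : 'I_m) : (2 < m)%N ->
  isolated m q 0 y -> stands_for q y x ->
  stands_for q (wreath_step y (ord_max, false)) (beta m x) /\
  stands_for q (wreath_step y (ord_max, true)) ((beta m)^-1%g x).
Proof.
move=> m3 iso yx.
have [x3|x3] := ltnP x 3; last first.
  have bx : beta m x = x by apply/val_inj; rewrite /= betaE // ltnNge x3.
  have b'x : (beta m)^-1%g x = x by rewrite -{1}bx permK.
  rewrite bx b'x /wreath_step /=; case: eqP => // y0; move: yx.
  case: y iso y0 => i k /= iso -> /(stands_for0 m3) xi.
  by have := ltn_ord i; lia.
have y0 : y.2 = 0.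
  have := iso 0 (Ordinal x3); rewrite addr0 => -> //.
  by move: yx; rewrite /stands_for -rpredN opprB.
case: y iso y0 yx => i k /= _ -> yx; rewrite /wreath_step /=.
have xi := stands_for0 m3 yx.
have st (j : 'I_3) (z : 'I_m) : z = j :> nat -> stands_for q (j, 0) z.
  by rewrite /stands_for /= mul0r addr0 => ->; rewrite subrr dvdz0.
split; apply: st; first by rewrite betaE // x3 xi.
have lt : (ord_pred i < m)%N by apply: leq_trans (ltn_ord _) m3.
suff -> : x = beta m (Ordinal lt) by rewrite permK.
apply/val_inj; rewrite /= betaE //= xi ltn_pmod //.
by case: i {xi yx lt x3} => -[|[|[|]]].
Qed.

(** Induction on [w] with isolation as invariant. A letter s or its inverse moves [y.2] by one and
    costs one unit of radius; after a letter t at y.2 = 0, isolation is recovered from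
    separation. *)
Lemma stands_for_act m q L (w : word 2) (y : 'I_3 * int) (x : 'I_m) :
  (2 < m)%N -> separated m q L -> (size w <= L)%N ->
  isolated m q (size w) y -> stands_for q y x ->
  stands_for q (wreath_act w y) (word_eval (@coord_gen m q) w x) /\
  `|(wreath_act w y).2 - y.2| <= (size w)%:Z.
Proof.
move=> m3 sep; elim: w x y => [|[i b] w IH] x y wL iso yx.
  by rewrite /word_eval big_nil perm1 /= subrr.
rewrite word_eval_cons permM [wreath_act _ _]/=.
set x' := fun_of_perm (if _ then _ else _) x; set y' := wreath_step _ _.
have [iso' yx' d] : [/\ isolated m q (size w) y', stands_for q y' x' & `|y'.2 - y.2| <= 1].
  have [i0|i0] := eqVneq i ord0; last first.
    have i1 : i = ord_max by case: (i) i0 => -[|[]] // ? _; apply/val_inj.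
    have [] := beta_stands_for m3 _ yx => [k j k0|yb yb'].
      by apply: iso; apply: le_trans k0 _.
    split; first 1 last.
    - by rewrite /y' /x' /coord_gen i1; case: (b).
    - by rewrite /y' /wreath_step i1 /=; case: eqP; case: (b); rewrite /= subrr.
    rewrite /y' /wreath_step i1 /=; case: eqP => [y0|_].
      apply: separated_isolated; rewrite /= y0; apply: separatedW sep.
      exact: ltnW.
    by move=> k j kw; apply: iso; rewrite /=; lia.
  have [e eE [-> yx']] : exists2 e : int, `|e| <= 1 &
      y' = (y.1, y.2 + e) /\ stands_for q (y.1, y.2 + e) x'.
    exists (if b then -1 else 1); first by case: (b).
    split; first by rewrite /y' /wreath_step i0 /=; case: (b).
    rewrite /x' /coord_gen i0 /= /stands_for /=; case: (b).
      set z := fun_of_perm _ x; have := shiftP q z.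
      rewrite permKV => /dvdzP[c cE]; move: yx => /dvdzP[c' cE'].
      by apply/dvdzP; exists (c' - c); lia.
    set z := fun_of_perm _ x; have : (m %| z%:Z - (x%:Z + q%:Z))%Z := shiftP q x.
    move=> /dvdzP[c cE]; move: yx => /dvdzP[c' cE'].
    by apply/dvdzP; exists (c' + c); lia.
  split=> //=; last by lia.
  by move=> k j kw dv; rewrite /= -addrA; apply: (iso _ j); rewrite /= ?addrA //; lia.
have [yw dw] := IH x' y' (ltnW wL) iso' yx'.
by split=> //=; lia.
Qed.

Lemma stands_for_exists m q (y : 'I_3 * int) : (0 < m)%N ->
  exists x : 'I_m, stands_for q y x.
Proof.
move=> m0; set z : int := y.1%:Z + y.2 * q%:Z.
have m0' : m%:Z != 0 by lia.
have lt : (`|(z %% m)%Z| < m)%N.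
  by have := modz_ge0 z m0'; have := ltz_pmod z (m0 : 0 < m%:Z); lia.
exists (Ordinal lt); apply/dvdzP; exists (- (z %/ m)%Z) => /=.
have := divz_eq z m; have := modz_ge0 z m0'; rewrite -/z; lia.
Qed.

Lemma stands_for_inj m q (y : 'I_3 * int) (x x' : 'I_m) :
  stands_for q y x -> stands_for q y x' -> x = x'.
Proof.
move=> /dvdzP[c cE] /dvdzP[c' cE']; apply/val_inj => /=.
have : x%:Z - x'%:Z = 0; last by lia.
apply: (@dvdz_small m); last by have := ltn_ord x; have := ltn_ord x'; lia.
by apply/dvdzP; exists (c - c'); lia.
Qed.

(** A point standing for [y] in a sufficiently separated coordinate also stands for
    [wreath_act w y]. The two exponents differ by at most |w|, so separation identifies them, and
    then the first components agree. *)
Lemma wreath_act_trivial (w : word 2) :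
  (forall L, exists m q, [/\ (2 < m)%N, separated m q L &
                             word_eval (@coord_gen m q) w = 1%g]) ->
  forall y, wreath_act w y = y.
Proof.
move=> w_triv y; set L := (`|y.2| + size w)%N.
have [m [q [m3 sep w1]]] := w_triv L.
have [x yx] := stands_for_exists q y (ltnW (ltnW m3)).
have [] := stands_for_act m3 sep (leq_addl _ _) (separated_isolated sep) yx.
rewrite w1 perm1; case: (wreath_act w y) => i k /=; case: y @L sep yx => i' k' /= sep.
have ltI := ltn_ord i; have ltI' := ltn_ord i'.
move=> /dvdzP[c /= cE] /dvdzP[c' /= cE'] kw.
have k0 : k - k' = 0.
  apply: (sep _ (i%:Z - i'%:Z)); [lia|lia|].
  by apply/dvdzP; exists (c - c'); lia.
have kk : k = k' by lia.
have : i%:Z - i'%:Z = 0.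
  apply: (@dvdz_small m); last by lia.
  by apply/dvdzP; exists (c - c'); subst k'; lia.
by move=> ii; rewrite kk; congr pair; apply/val_inj => /=; lia.
Qed.

(** As [u] inverts [q] modulo [m], every point lies on the s-orbit of 0 and has a description. The
    radius 2|w| allows for a description with exponent up to |w|, isolated for |w| further steps. *)
Lemma word_eval_coord_trivial m q (u : int) (w : word 2) :
  (2 < m)%N -> (m %| u * q%:Z - 1)%Z -> separated m q (2 * size w) ->
  (forall y, wreath_act w y = y) -> word_eval (@coord_gen m q) w = 1%g.
Proof.
move=> m3 /dvdzP[c cE] sep w_triv; apply/permP => x; rewrite perm1.
have [y [yx iso]] : exists y, stands_for q y x /\ isolated m q (size w) y.
  pose k := u * x%:Z; have kx : stands_for q (ord0, k) x.
    apply/dvdzP; exists (- c * x%:Z); have -> : - c * x%:Z * m = - (c * m%:Z) * x%:Z by lia.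
    by rewrite -cE /k /=; lia.
  (* If the s-orbit of x meets some j in {0, 1, 2} within |w| steps, then x is
     described from j; otherwise any description of x is isolated. *)
  have [iso|] := EM (isolated m q (size w) (ord0, k)); first by exists (ord0, k).
  move=> /existsNP[k' /existsNP[j /not_implyP[k'w /not_implyP[/dvdzP[c1 /= c1E] _]]]].
  have /dvdzP[c2 /= c2E] := kx.
  exists (j, - k'); split; first by apply/dvdzP; exists (c1 + c2) => /=; lia.
  by apply: separated_isolated; apply: separatedW sep; rewrite /=; lia.
have [] := stands_for_act m3 sep _ iso yx; first by lia.
by rewrite w_triv => yx' _; exact: stands_for_inj yx' yx.
Qed.

(** * Commutators of the 3-cycle with its conjugates *)

Lemma shift_stands_for m q a (x : 'I_m) :
  (m %| ((alpha m ^+ q ^+ a : 'S_m)%g x)%:Z - (x%:Z + a%:Z * q%:Z))%Z.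
Proof. by rewrite -expgM mulrC -PoszM; apply: shiftP. Qed.

Lemma beta_on m : (2 < m)%N -> perm_on [set x : 'I_m | (x < 3)%N] (beta m).
Proof.
move=> m3; rewrite /perm_on; apply/fintype.subsetP => x.
rewrite !inE; apply: contraR => x3.
by apply/eqP/val_inj; rewrite /= betaE // (negbTE x3).
Qed.

Lemma perm_onJ (T : finType) (A : {set T}) (s t : {perm T}) :
  perm_on A s -> perm_on (t @: A) (s ^ t)%g.
Proof.
move=> As; rewrite /perm_on; apply/fintype.subsetP => x.
rewrite !inE -{1 2 3}[x](permKV t) permJ (inj_eq perm_inj).
by move=> sx; apply: imset_f; apply: (fintype.subsetP As).
Qed.

(** A common point of the two supports would make aq + r divisible by [m] for some |r| <= 2. *)
Lemma conj_beta_commute m q a : (2 < m)%N -> separated m q a -> (0 < a)%N ->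
  commute (beta m) (beta m ^ (alpha m ^+ q ^+ a))%g.
Proof.
move=> m3 sep a0; apply: perm_onC (beta_on m3) (perm_onJ _ (beta_on m3)) _.
rewrite -setI_eq0; apply/eqP/setP => x; rewrite !inE; apply/negP => /andP[x3].
case/imsetP=> y; rewrite inE => y3 xy.
have /dvdzP[c] := shift_stands_for q a y; rewrite -xy => cE.
suff: a%:Z = 0 by lia.
by apply: (sep _ (y%:Z - x%:Z)); [lia|lia|]; apply/dvdzP; exists (- c); lia.
Qed.

Lemma perm_onR (T : finType) (A B : {set T}) (s t : {perm T}) :
  perm_on A s -> perm_on B t -> perm_on (A :|: B) [~ s, t]%g.
Proof.
move=> As Bt.
have sAB : perm_on (A :|: B) s by exact: fintype.subset_trans As (finset.subsetUl _ _).
have tAB : perm_on (A :|: B) t by exact: fintype.subset_trans Bt (finset.subsetUr _ _).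
by rewrite commgEl /conjg; do ?[apply: perm_onM | apply: perm_onV].
Qed.

(** Since s^p shifts by -2, the inner commutator moves only residues between -2 and 2. If s^M
    commuted with it, s^M would preserve its support, so Mq + r would vanish modulo [m] for some |r|
    <= 4; [dvdz_pq] then gives 2M = rp <= 4p, against 2p < M. *)
Lemma commutator_not_periodic (p q M : nat) :
  (3 <= q)%N -> (0 < p)%N -> (2 * p < M)%N -> (4 * p + 2 * M < p * q + 2)%N ->
  let m := (p * q + 2)%N in let s : 'S_m := (alpha m ^+ q)%g in
  ([~ [~ beta m, beta m ^ (s ^+ p)], s ^+ M] <> 1)%g.
Proof.
move=> q3 p0 pM Mq m s.
have m5 : (4 < m)%N by rewrite /m; nia.
have m3 : (2 < m)%N by apply: ltn_trans m5.
set u : 'S_m := (s ^+ p)%g; set b := beta m; set c : 'S_m := [~ b, _]%g.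
have uE (x : 'I_m) : (m %| (u x)%:Z - x%:Z + 2)%Z.
  have : (m %| (u x)%:Z - (x%:Z + p%:Z * q%:Z))%Z := shift_stands_for q p x.
  by move=> /dvdzP[e eE]; apply/dvdzP; exists (e + 1); rewrite mulrDl -eE /m; lia.
have u_lt2 (x y : 'I_m) : x = y.+2 :> nat -> u x = y.
  move=> xy; apply/val_inj => /=; have := uE x; set z := u x => dv.
  have : z%:Z - x%:Z + 2 = 0; last by lia.
  by apply: (@dvdz_small m) => //; have := ltn_ord x; have := ltn_ord z; lia.
(* If [b] and [b ^ u] commuted, evaluation at 2 would give u 0 = 0, so [m] would divide 2. The point
   4 is the preimage of 2 under [u], and [b] fixes it. *)
have c1 : c != 1%g.
  pose i0 : 'I_m := Ordinal (ltn_trans (isT : 0 < 2)%N m3).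
  pose i2 : 'I_m := Ordinal m3; pose i4 : 'I_m := Ordinal m5.
  have u2 : u i2 = i0 by apply: u_lt2.
  have u4 : u i4 = i2 by apply: u_lt2.
  have b2 : b i2 = i0 by apply/val_inj; rewrite /= betaE.
  have b4 : b i4 = i4 by apply/val_inj; rewrite /= betaE.
  apply/negP => /commgP bC.
  have : (b ^ u)%g (b i2) = b ((b ^ u)%g i2) by rewrite -!permM bC.
  rewrite b2 -[X in _ = b ((b ^ u)%g X)]u4 permJ b4 u4 b2 -[X in (b ^ u)%g X]u2 permJ b2.
  move=> u0; have := uE i0; rewrite u0 => /dvdz_small H.
  by have := H _; rewrite /=; lia.
have near (z : 'I_m) : c z != z -> exists2 r : int, `|r| <= 2 & (m %| z%:Z - r)%Z.
  move=> cz; have /fintype.subsetP /(_ z) := perm_onR (beta_on m3) (perm_onJ u (beta_on m3)).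
  rewrite !inE => /(_ cz) /orP[z3|/imsetP[y]].
    by exists z%:Z; [lia | rewrite subrr dvdz0].
  rewrite inE => y3 ->; exists (y%:Z - 2); first by lia.
  suff -> : (u y)%:Z - (y%:Z - 2) = (u y)%:Z - y%:Z + 2 by exact: uE.
  by lia.
move=> /eqP /commgP comm.
have [z cz] : exists z, c z != z.
  by apply/existsP; apply: contraR c1 => /existsPn H; apply/eqP/permP => z;
    rewrite perm1; apply/eqP; have := H z; rewrite negbK.
pose z1 : 'I_m := (s ^+ M)%g z.
have cz1 : c z1 != z1.
  by rewrite /z1 -permM -comm permM (inj_eq perm_inj).
have [r r2 /dvdzP[e eE]] := near _ cz; have [r' r2' /dvdzP[e' eE']] := near _ cz1.
have /dvdzP[e'' eE''] : (m %| z1%:Z - (z%:Z + M%:Z * q%:Z))%Z.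
  exact: shift_stands_for.
have dv : (m %| M%:Z * q%:Z + (r - r'))%Z.
  by apply/dvdzP; exists (e' - e - e''); lia.
have : 2 * M%:Z = (r - r') * p%:Z by apply: dvdz_pq dv; nia.
by nia.
Qed.

End Coordinates.

(** * Generators and coordinate projections of N(d, q) *)

Section GroupN.
Variables d q : nat -> nat.
Local Open Scope group_scope.

Definition groupN_gen (i : 'I_2) : groupN d q :=
  if i == ord0 then GenGroup (sub_gen_subgroup (or_introl (erefl (gen_s d q))))
  else GenGroup (sub_gen_subgroup (or_intror (erefl (gen_t d)))).

Definition groupN_coord (n : posnat) (x : groupN d q) : 'S_(d (val n)) := val x n.

Fact groupN_coordF n : {morph @groupN_coord n : x y / x * y^-1}.
Proof. by []. Qed.

HB.instance Definition _ n :=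
  isGroupMorphism.Build _ _ (@groupN_coord n) (@groupN_coordF n).

Lemma groupN_coord_gen n i :
  groupN_coord n (groupN_gen i) = coord_gen (d (val n)) (q (val n)) i.
Proof. by rewrite /groupN_gen /coord_gen; case: eqP. Qed.

Lemma groupN_generated (x : groupN d q) : exists w, word_eval groupN_gen w = x.
Proof.
by apply: gen_group_word_eval => y [] ->; [exists ord0 | exists ord_max].
Qed.

Lemma groupN_coord_inj (x : groupN d q) : (forall n, groupN_coord n x = 1) -> x = 1.
Proof. by move=> x1; apply/val_inj/functional_extensionality_dep => n; apply: x1. Qed.

Lemma groupN_coord_eval n w :
  groupN_coord n (word_eval groupN_gen w) = word_eval (@coord_gen (d (val n)) (q (val n))) w.
Proof.
rewrite word_eval_morph; congr word_eval; apply: functional_extensionality_dep => i.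
exact: groupN_coord_gen.
Qed.

End GroupN.

(** * The comparison group and the contradiction *)

Lemma common_multiple (d : nat -> nat) N : (forall n, 0 < n -> 0 < d n) ->
  exists2 M, 0 < M & forall n, 0 < n <= N -> d n %| M.
Proof.
move=> d0; elim: N => [|N [M M0 dM]]; first by exists 1 => // -[].
exists (d N.+1 * M) => [|n /andP[n0]]; first by rewrite muln_gt0 d0.
by rewrite leq_eqVlt => /predU1P[->|nN]; [exact: dvdn_mulr | rewrite dvdn_mull // dM ?n0].
Qed.

Theorem corollary1p6 (R : realType) (f d p q : nat -> nat)
  (f_incr : forall m n : nat, 0 < m -> m <= n -> f m <= f n)
  (f_ge : forall n : nat, 0 < n -> n <= f n)
  (dpq : B_parameters f d p q)
  (f_fast : ~ preceq (R := R) (fun n => (f n)%:R%R) (fun n => expR (expR n%:R%R))) :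
  ~ finitely_presentable (groupN d q).
Proof.
move=> /finitely_presentable_relators /(_ (@groupN_generated d q)) [Rel RelG univ].
have p_ge n : 0 < n -> n <= p n.
  elim: n => // -[|n] IH _; first by rewrite (B_p_one dpq).
  exact: leq_ltn_trans (IH _) (B_p_strict dpq _ (ltnSn _)).
have q3 n : 0 < n -> 3 <= q n by move=> n0; exact: (B_q_ge3 dpq).
have dE n : 0 < n -> d n = p n * q n + 2 by move=> n0; exact: (B_d_def dpq).
have d3 n : 0 < n -> 2 < d n.
  by move=> n0; have := p_ge n n0; have := q3 n n0; rewrite dE //; nia.
have sep L n : 0 < n -> 2 * L < p n -> separated (d n) (q n) L.
  by move=> n0 Lp; rewrite dE //; apply: separated_pq (q3 n n0).
(* [a] exceeds 2(2L), as [separated_pq] requires for the radius 2|r| of each relator r. *)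
pose L := \max_(r <- Rel) size r; pose a := 4 * L + 1.
have a0 : 0 < a by rewrite /a addn1.
(* Because n <= p n, the indices up to 2a include every coordinate with p n <= 2a. The factor 2a + 1
   in [M] below ensures 2a < M. *)
have [M0 M0_gt0 dM0] := common_multiple (2 * a) (fun n n0 => ltnW (ltnW (d3 n n0))).
(* q' is odd, hence invertible mod m, and m > 4 a + 2 M > 8 a. *)
pose M := M0 * (2 * a).+1; pose b := 4 + 2 * M; pose q' := 2 * b + 1.
pose m := a * q' + 2.
have [r rRel|phi phiE] := univ _ (@coord_gen m q').
  have rL : size r <= L by apply: (@leq_bigmax_seq _ Rel xpredT size).
  apply: (@word_eval_coord_trivial m q' (Posz (1 + b * a))).
  (* The inverse of q' = 2b + 1 modulo [m] is 1 + ba, since (1 + ba)q' - 1 = b(aq' + 2) = bm. *)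
  - by rewrite /m addn2 !ltnS muln_gt0 /a /q' !addn1.
  - by apply/dvdzP; exists (Posz b); rewrite /m /q'; lia.
  - apply: separated_pq; first by rewrite /a addn1 ltnS mulnA leq_pmul2l.
    by rewrite /q' /b; lia.
  (* The coordinate 2L' + 1 is separated to radius L', because p n >= n > 2L'. *)
  apply: wreath_act_trivial => L'; pose n : posnat := exist _ (2 * L').+1 isT.
  exists (d (val n)), (q (val n)); split; [exact: d3 | by apply: sep => //; apply: p_ge |].
  by rewrite -groupN_coord_eval (RelG r rRel) gmulf1.
have sM : [~ [~ groupN_gen d q ord_max, groupN_gen d q ord_max ^ (groupN_gen d q ord0 ^+ a)],
        groupN_gen d q ord0 ^+ M]%g = 1%g.
  apply: groupN_coord_inj => n; rewrite !gmulfR gmulfJ !gmulfXn /= !groupN_coord_gen /coord_gen /=.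
  have n0 : 0 < val n := valP n.
  have [pa|ap] := leqP (p (val n)) (2 * a).
    have -> : (alpha (d (val n)) ^+ q (val n) ^+ M = 1)%g; last by rewrite commg1.
    rewrite -expgM; apply: alphaX_dvd; rewrite dvdn_mull // dvdn_mulr // dM0 // n0.
    exact: leq_trans (p_ge _ n0) pa.
  have /commgP/eqP -> := conj_beta_commute (d3 _ n0) (sep _ _ n0 ap) a0.
  by rewrite comm1g.
have := congr1 phi sM; rewrite !gmulfR gmulfJ !gmulfXn !phiE gmulf1.
by apply: commutator_not_periodic; rewrite /M /q' /b /a; nia.
Qed.
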